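(* Let $d\geq 1$ and let $k$ be an integer with $1\leq k\leq d^{1/4}/2$. Then any one-sided non-adaptive tester for $k$-monotonicity of functions $f\colon\{0,1\}^d\to\{0,1\}$ (for a suitable constant distance parameter $\varepsilon$) must make $(\Omega(d/k^2))^{k/4}$ queries.
   Context: The hypercube $\{0,1\}^d$ is ordered coordinatewise ($x\preceq y$ iff $x_i\leq y_i$ for all $i$). For a finite poset $\mathcal{D}$ and an integer $k\geq 0$, a function $f\colon\mathcal{D}\to\{0,1\}$ is $k$-monotone if there do not exist $x_1\preceq x_2\preceq\cdots\preceq x_{k+1}$ in $\mathcal{D}$ with $f(x_1)=1$ and $f(x_i)\neq f(x_{i+1})$ for all $i\in[k]$. The distance between $f,g\colon\mathcal{D}\to\{0,1\}$ is $\mathrm{dist}(f,g)=\Pr_{x}[f(x)\neq g(x)]$ for uniform $x\in\mathcal{D}$; the distance of $f$ to a property is the minimum distance to a function in it, and $f$ is $\varepsilon$-far if this distance is at least $\varepsilon$. A tester for a property with parameter $\varepsilon$ is a randomized algorithm with query access to $f$ that accepts with probability at least $2/3$ if $f$ has the property and rejects with probability at least $2/3$ if $f$ is $\varepsilon$-far from it. It is one-sided if it accepts every $f$ having the property with probability $1$, and non-adaptive if its queries depend only on its internal randomness and not on previous answers. *)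

(* Defs.v *)
From HB Require Import structures.
From mathcomp Require Import all_boot all_order all_algebra.
From mathcomp Require Import reals exp.
Set Implicit Arguments. Unset Strict Implicit. Unset Printing Implicit Defensive.
Import Order.TTheory GRing.Theory Num.Theory.
Local Open Scope ring_scope.

Definition cube (d : nat) : finType := {ffun 'I_d -> bool}.

Definition cube_le (d : nat) (x y : cube d) : bool := [forall i, x i ==> y i].

Definition k_monotone (d k : nat) (f : cube d -> bool) : Prop :=
  ~ (exists x : nat -> cube d,
        (forall i, (i < k)%N -> cube_le (x i) (x i.+1)) /\
        f (x 0%N) = true /\
        (forall i, (i < k)%N -> f (x i) != f (x i.+1))).

Definition dist (R : realType) (d : nat) (f g : cube d -> bool) : R :=
  (#|[set x : cube d | f x != g x]|)%:R / (#|{: cube d}|)%:R.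

Definition far_from_k_monotone (R : realType) (d k : nat) (eps : R)
    (f : cube d -> bool) : Prop :=
  forall g : cube d -> bool, k_monotone k g -> eps <= dist R f g.

(* A non-adaptive randomized algorithm making q queries is given by a
   finite probability space (Omega, p) of random seeds, a query tuple
   Q w chosen from the seed alone (non-adaptivity), and an accept/reject
   decision D w applied to the answers (true = accept). *)
Definition is_distribution (R : realType) (Omega : finType) (p : Omega -> R) : Prop :=
  (forall w, 0 <= p w) /\ \sum_(w : Omega) p w = 1.

Definition accept_prob (R : realType) (d q : nat) (Omega : finType) (p : Omega -> R)
    (Q : Omega -> q.-tuple (cube d)) (D : Omega -> q.-tuple bool -> bool)
    (f : cube d -> bool) : R :=
  \sum_(w : Omega | D w (map_tuple f (Q w))) p w.

Definition one_sided_nonadaptive_tester (R : realType) (d k q : nat) (eps : R)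
    (Omega : finType) (p : Omega -> R)
    (Q : Omega -> q.-tuple (cube d)) (D : Omega -> q.-tuple bool -> bool) : Prop :=
  is_distribution p /\
  (forall f, k_monotone k f -> accept_prob p Q D f = 1) /\
  (forall f, k_monotone k f -> accept_prob p Q D f >= 2%:R / 3%:R) /\
  (forall f, far_from_k_monotone k eps f -> 1 - accept_prob p Q D f >= 2%:R / 3%:R).

(* Main.v *)
Require Import Defs.
From HB Require Import structures.
From mathcomp Require Import all_boot all_order all_algebra.
From mathcomp Require Import reals sequences exp.
From mathcomp Require Import zify ring lra.
Import Order.TTheory GRing.Theory Num.Theory.
Local Open Scope ring_scope.
Set Implicit Arguments. Unset Strict Implicit. Unset Printing Implicit Defensive.

(* Hide a set S of s = 4 (k+1)^2 coordinates. The hard function is the parity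
   of x_S in the middle layers |2 |x_(~S)| - (d - s)| <= 2 sqrt d, and constant
   below and above them. A one-sided non-adaptive tester can only reject when
   its queries contain a violating chain, because otherwise they extend to a
   k-monotone function; the extremities of such a chain are two comparable
   middle points that differ in at least k coordinates of S but in at most
   6 sqrt d coordinates altogether. With S a random transversal of s disjoint
   blocks of d / s coordinates, a Chernoff bound shows that a fixed pair of
   points does so with probability (O(k / sqrt d))^k, so q^2 pairs are too few
   unless q^2 >= (Omega(sqrt d / k))^k.

   The hard function is 1/16-far from k-monotone: split {0,1}^S into symmetric
   chains. A k-monotone function flips at most k times along a chain of l
   points, whereas the parity flips at every step, so they disagree on at least
   (l - k - 1) / 2 of them. For a uniform point, the length l of its chain
   satisfies E l^2 = 3 s + 1 and E l^4 = 15 s^2 + 1, hence is at least 2 (k+1)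
   with constant probability; Chebyshev's inequality handles the middle layers. *)

(** * The coordinatewise order, and extension of partial functions to [k]-monotone ones *)

Lemma cube_leP (d : nat) (x y : cube d) :
  reflect (forall i, x i -> y i) (cube_le x y).
Proof.
apply: (iffP forallP) => [h i | h i]; first exact/implyP.
exact/implyP/h.
Qed.

Lemma cube_le_refl (d : nat) (x : cube d) : cube_le x x.
Proof. exact/cube_leP. Qed.

Lemma cube_le_trans (d : nat) (x y z : cube d) :
  cube_le x y -> cube_le y z -> cube_le x z.
Proof. by move=> /cube_leP xy /cube_leP yz; apply/cube_leP => i /xy /yz. Qed.

Section Extension.
Variables (d : nat) (P : pred (cube d)) (f : cube d -> bool).

(** The chain is read from the top; tying each value to the rank from the bottom makes the lowest
    value [true]. *)
Fixpoint alt_chain_below (n : nat) (x : cube d) : bool :=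
  if n is m.+1 then
    [exists y, [&& P y, cube_le y x, f y == ~~ odd m & alt_chain_below m y]]
  else true.

Lemma alt_chain_below_mono n x y :
  cube_le x y -> alt_chain_below n x -> alt_chain_below n y.
Proof.
case: n => //= n xy /existsP[z /and4P[Pz zx fz hz]]; apply/existsP; exists z.
by rewrite Pz fz hz (cube_le_trans zx xy).
Qed.

(** The extension is the parity of [L x], the largest length of an alternating chain in [P] below
    [x]. [L] is monotone and at most [k], which limits alternations; a point of [P] with the wrong
    parity would prolong its own longest chain. *)
Lemma k_monotone_extension (k : nat) :
  (forall x, ~~ alt_chain_below k.+1 x) ->
  exists2 g : cube d -> bool, k_monotone k g & forall x, P x -> g x = f x.
Proof.
move=> noviol.
pose L x := (\max_(n < k.+1 | alt_chain_below n x) n)%N.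
have L_below x : alt_chain_below (L x) x.
  rewrite /L; elim/big_ind: _ => // a b ha hb.
  by rewrite /maxn; case: ifP.
have L_max n x : (n <= k)%N -> alt_chain_below n x -> (n <= L x)%N.
  move=> nk hn.
  exact: (@leq_bigmax_cond _ (fun n : 'I_k.+1 => alt_chain_below n x)
            (fun n : 'I_k.+1 => n : nat) (Ordinal (nk : (n < k.+1)%N))).
have L_le x : (L x <= k)%N by apply/bigmax_leqP => i _; rewrite -ltnS.
have L_mono x y : cube_le x y -> (L x <= L y)%N.
  by move=> xy; apply: L_max => //; apply: alt_chain_below_mono xy _.
exists (fun x => odd (L x)).
  move=> [x [xle [x0 xalt]]].
  have grow i : (i <= k)%N -> (i < L (x i))%N.
    elim: i => [|i IH] ik; first by case: (L (x 0%N)) x0.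
    apply: leq_ltn_trans (IH (ltnW ik)) _.
    rewrite ltn_neqAle (L_mono _ _ (xle _ ik)) andbT.
    by apply: contraNneq (xalt _ ik) => ->.
  by have := leq_trans (grow k (leqnn k)) (L_le (x k)); rewrite ltnn.
move=> x Px; apply/eqP; rewrite eq_sym; apply/negPn/negP => fx.
have hS : alt_chain_below (L x).+1 x.
  rewrite /=; apply/existsP; exists x; rewrite Px cube_le_refl L_below /= andbT.
  by case: (f x) (odd (L x)) fx => [] [].
have := L_le x; rewrite leq_eqVlt => /orP[/eqP Lk | /L_max /(_ hS)].
  by move: hS; rewrite Lk (negPf (noviol x)).
by rewrite ltnn.
Qed.

End Extension.

(** * Flips along chains: parity against a [k]-monotone function *)

Section Chains.
Variables (d k : nat) (g : cube d -> bool).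

Fixpoint flips (x : cube d) (c : seq (cube d)) : nat :=
  if c is y :: c' then ((g x != g y) + flips y c')%N else 0%N.

Lemma flips_alternation m x c : path (@cube_le d) x c -> (m <= flips x c)%N ->
  exists y : nat -> cube d, [/\ y 0%N = x,
    forall i, (i < m)%N -> cube_le (y i) (y i.+1) &
    forall i, (i < m)%N -> g (y i) != g (y i.+1)].
Proof.
elim: c x m => [|y c IH] x m /=.
  by move=> _; rewrite leqn0 => /eqP ->; exists (fun=> x).
move=> /andP[xy pc]; case: (boolP (g x != g y)) => [gxy | /negPn/eqP gxy].
  case: m => [|m]; first by exists (fun=> x).
  rewrite add1n ltnS => /(IH _ _ pc)[z [z0 zle zalt]].
  exists (fun i => if i is j.+1 then z j else x); split=> //.
    by move=> [|i] im; [rewrite z0 | apply: zle].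
  by move=> [|i] im; [rewrite z0 | apply: zalt].
rewrite add0n => /(IH _ _ pc)[z [z0 zle zalt]].
exists (fun i => if i is j.+1 then z j.+1 else x); split=> //.
  move=> [|i] im; last exact: zle.
  by apply: cube_le_trans xy _; rewrite -z0; apply: zle.
move=> [|i] im; last exact: zalt.
by rewrite gxy -z0; apply: zalt.
Qed.

Lemma k_monotone_flips x c :
  k_monotone k g -> path (@cube_le d) x c -> (flips x c <= k)%N.
Proof.
move=> kg pc; rewrite leqNgt; apply/negP => /(flips_alternation pc).
move=> [y [y0 yle yalt]]; apply: kg.
case gx: (g x).
  exists y; rewrite y0; split; first by move=> i ik; apply: yle; apply: ltnW.
  by split=> // i ik; apply: yalt; apply: ltnW.
(* A chain that starts at [false] drops its first point; of [k.+1] flips, [k] remain, now starting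
   from [true]. *)
exists (fun i => y i.+1); split; first by move=> i ik; apply: yle.
split; last by move=> i ik; apply: yalt.
by have := yalt 0%N isT; rewrite y0 gx; case: (g _).
Qed.

(* Each of the [size c] steps is a flip of [g] or has an end where [g] and [h]
   disagree; the summand [h x != g x] on the left, valid because the head [x]
   is an end of one step only, makes the induction work. *)
Lemma disagreements_flips (h : cube d -> bool) x c :
  path (fun x y => h x != h y) x c ->
  (size c + (h x != g x) <= flips x c + 2 * count (fun y => h y != g y) (x :: c))%N.
Proof.
elim: c x => [|y c IH] x /=; first by move=> _; case: (h x != g x).
move=> /andP[hxy /IH] /=; move: hxy.
by case: (h x); case: (h y); case: (g x); case: (g y) => //=; lia.
Qed.

End Chains.

Definition weight (d : nat) (x : cube d) : nat := (\sum_i x i)%N.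

Definition parity (d : nat) (x : cube d) : bool := odd (weight x).

Lemma weight_le (d : nat) (x y : cube d) : cube_le x y -> (weight x <= weight y)%N.
Proof.
move=> /cube_leP xy; apply: leq_sum => i _.
by case: (x i) (xy i) => // ->.
Qed.

Definition cover (d : nat) : rel (cube d) :=
  fun x y => cube_le x y && (weight y == (weight x).+1).

Lemma chain_disagreements (d k : nat) (g : cube d -> bool) (c : seq (cube d)) :
  k_monotone k g -> sorted (@cover d) c ->
  (size c <= k.+1 + 2 * count (fun y => parity y != g y) c)%N.
Proof.
case: c => [//|x c] kg /= pc.
have p1 : path (@cube_le d) x c by apply: sub_path pc => y z /andP[].
have p2 : path (fun y z => parity y != parity z) x c.
  apply: sub_path pc => y z /andP[_ /eqP wz]; rewrite /parity wz /=.
  by case: (odd _).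
have := k_monotone_flips kg p1; have := disagreements_flips g p2.
by rewrite /=; lia.
Qed.

(** * Symmetric chain decomposition of the cube *)

Definition cube_cons (n : nat) (b : bool) (x : cube n) : cube n.+1 :=
  [ffun i => oapp x b (unlift ord0 i)].

Lemma cube_cons0 n b (x : cube n) : cube_cons b x ord0 = b.
Proof. by rewrite ffunE unlift_none. Qed.

Lemma cube_consS n b (x : cube n) i : cube_cons b x (lift ord0 i) = x i.
Proof. by rewrite ffunE liftK. Qed.

Lemma weight_cons n b (x : cube n) : weight (cube_cons b x) = (b + weight x)%N.
Proof.
rewrite /weight big_ord_recl cube_cons0; congr addn.
by apply: eq_bigr => i _; rewrite cube_consS.
Qed.

Lemma cube_le_cons n (b b' : bool) (x y : cube n) : (b -> b') -> cube_le x y ->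
  cube_le (cube_cons b x) (cube_cons b' y).
Proof.
move=> bb' /cube_leP xy; apply/cube_leP => i.
by case: (unliftP ord0 i) => [j|] ->; rewrite ?cube_cons0 ?cube_consS //; apply: xy.
Qed.

Lemma cover_cons n b (x y : cube n) : cover x y ->
  cover (cube_cons b x) (cube_cons b y).
Proof.
move=> /andP[xy /eqP wy]; rewrite /cover cube_le_cons // !weight_cons wy.
by rewrite addnS eqxx.
Qed.

Lemma sum_cube_cons (V : nmodType) n (F : cube n.+1 -> V) :
  \sum_x F x = \sum_x (F (cube_cons false x) + F (cube_cons true x)).
Proof.
pose h (p : bool * cube n) := cube_cons p.1 p.2.
pose h' (x : cube n.+1) := (x ord0, [ffun i => x (lift ord0 i)] : cube n).
rewrite (reindex h) /=; last first.
  exists h' => [[b x] _ | x _]; rewrite /h /h' /=.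
    rewrite cube_cons0; congr pair.
    by apply/ffunP => i; rewrite ffunE cube_consS.
  apply/ffunP => i; case: (unliftP ord0 i) => [j|] ->.
    by rewrite cube_consS ffunE.
  by rewrite cube_cons0.
rewrite -(pair_bigA _ (fun b x => F (cube_cons b x))) /= big_bool /=.
by rewrite addrC big_split.
Qed.

(* The symmetric chain decomposition: [x0 < ... < xl] produces
   [0x0 < 1x0 < 1x1 < ... < 1xl] and [0x1 < ... < 0xl] (possibly empty; empty
   chains are kept and stay empty). *)
Definition long_lift n (c : seq (cube n)) : seq (cube n.+1) :=
  if c is x :: _ then cube_cons false x :: map (cube_cons true) c else [::].

Definition short_lift n (c : seq (cube n)) : seq (cube n.+1) :=
  map (cube_cons false) (behead c).

Fixpoint scd (n : nat) : seq (seq (cube n)) :=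
  if n is m.+1 then flatten [seq [:: long_lift c; short_lift c] | c <- scd m]
  else [:: [:: [ffun=> false]]].

Lemma big_scdS (V : nmodType) n (F : seq (cube n.+1) -> V) :
  \sum_(c <- scd n.+1) F c =
  \sum_(c <- scd n) (F (long_lift c) + F (short_lift c)).
Proof.
rewrite /= big_flatten big_map; apply: eq_bigr => c _.
by rewrite !big_cons big_nil /= addr0.
Qed.

Lemma scd_sorted n c : c \in scd n -> sorted (@cover n) c.
Proof.
elim: n c => [|n IH] c; first by rewrite inE => /eqP ->.
move=> /flatten_mapP[c' /IH sc']; rewrite !inE => /orP[] /eqP -> {c}.
  case: c' sc' => //= x c' pc.
  apply/andP; split; last first.
    rewrite path_map; apply: sub_path pc => y z; exact: cover_cons.
  by rewrite /cover cube_le_cons ?cube_le_refl // !weight_cons eqxx.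
rewrite /short_lift sorted_map; case: c' sc' => //= x c' /path_sorted.
by apply: sub_sorted => y z; apply: cover_cons.
Qed.

Lemma scd_partition (V : nmodType) n (F : cube n -> V) :
  \sum_(c <- scd n) \sum_(x <- c) F x = \sum_x F x.
Proof.
elim: n F => [|n IH] F.
  rewrite /= big_seq1 big_seq1 (bigD1 [ffun=> false]) //= big1 ?addr0 //.
  by move=> x /eqP[]; apply/ffunP => -[].
rewrite big_scdS sum_cube_cons -IH; apply: eq_bigr => -[|x c] _.
  by rewrite !big_nil addr0.
rewrite /= /short_lift !big_cons !big_map /= -!addrA; congr (_ + _).
by rewrite big_split /=; congr (_ + _); apply: addrC.
Qed.

(** * Moments of the chain lengths, and the distance of parity from [k]-monotone *)

Section Moments.
Variable R : comNzRingType.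

Lemma scd_moment1 n : \sum_(c <- scd n) (size c)%:R = (2 ^+ n : R).
Proof.
elim: n => [|n IH]; first by rewrite big_seq1.
rewrite big_scdS exprSr -IH mulr_suml; apply: eq_bigr => -[|x c] _ /=.
  by rewrite addr0 mul0r.
by rewrite /short_lift !size_map /= -!(natr1, natrD); ring.
Qed.

(** A nonempty chain of length l lifts to lengths l + 1 and l - 1, and (l+1)^3 + (l-1)^3 = 2 l^3 + 6
    l; for an empty chain all terms vanish. The fifth moment works likewise. As a chain has l
    points, these are the moments of order 2 and 4 for a uniform point. *)
Lemma scd_moment3 n :
  \sum_(c <- scd n) (size c)%:R ^+ 3 = 2 ^+ n * (3 * n%:R + 1) :> R.
Proof.
elim: n => [|n IH]; first by rewrite big_seq1 /=; ring.
have -> : 2 ^+ n.+1 * (3 * n.+1%:R + 1) =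
  2 * (2 ^+ n * (3 * n%:R + 1)) + 6 * 2 ^+ n :> R by rewrite exprS -natr1; ring.
rewrite big_scdS -IH -(scd_moment1 n) !mulr_sumr -big_split /=.
apply: eq_bigr => -[|x c] _ /=; first by rewrite /=; ring.
by rewrite /short_lift !size_map /= -!natr1; ring.
Qed.

Lemma scd_moment5 n :
  \sum_(c <- scd n) (size c)%:R ^+ 5 = 2 ^+ n * (15 * n%:R ^+ 2 + 1) :> R.
Proof.
elim: n => [|n IH]; first by rewrite big_seq1 /=; ring.
have -> : 2 ^+ n.+1 * (15 * n.+1%:R ^+ 2 + 1) =
  2 * (2 ^+ n * (15 * n%:R ^+ 2 + 1)) + 20 * (2 ^+ n * (3 * n%:R + 1))
  + 10 * 2 ^+ n :> R by rewrite exprS -natr1; ring.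
rewrite big_scdS -IH -(scd_moment3 n) -(scd_moment1 n) !mulr_sumr -!big_split /=.
apply: eq_bigr => -[|x c] _ /=; first by rewrite /=; ring.
by rewrite /short_lift !size_map /= -!natr1; ring.
Qed.

End Moments.

(* With [u = 1/n], an odd polynomial of degree 5 in the chain length [l] that
   stays below the number of disagreements: its sum over the chains is given by
   exact moments, so no estimate of binomial coefficients is needed. *)
Lemma chain_minorant (R : realFieldType) (l m K u : R) :
  0 <= l -> 0 <= m -> 1 <= K -> l <= K + 2 * m -> 0 < u -> 4 * K ^+ 2 * u <= 1 ->
  l * (- 1 + l ^+ 2 * u - (l ^+ 2 * u) ^+ 2 / 10) <= 6 * m.
Proof.
move=> l0 m0 K1 lm u0 Ku.
(* Put t = l^2 u. If l <= 2 K, then t <= 1 and the bracket is negative; otherwise it is at most 3/2,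
   its value at t = 5, and l <= K + 2 m gives l <= 4 m. *)
have [lK|Kl] := leP l (2 * K).
  have t1 : l ^+ 2 * u <= 1.
    apply: le_trans Ku; rewrite ler_pM2r //.
    have : l * l <= (2 * K) * (2 * K) by apply: ler_pM => //.
    lra.
  apply: (@le_trans _ _ 0); last lra.
  apply: mulr_ge0_le0 => //.
  have := sqr_ge0 (l ^+ 2 * u); lra.
have : - 1 + l ^+ 2 * u - (l ^+ 2 * u) ^+ 2 / 10 <= 3 / 2.
  have := sqr_ge0 (l ^+ 2 * u - 5); lra.
move=> /(ler_wpM2l l0); lra.
Qed.

Lemma parity_far (R : realFieldType) (n k : nat) (g : cube n -> bool) :
  k_monotone k g -> (4 * k.+1 ^ 2 <= n)%N ->
  2 ^+ n / 12 <= (\sum_x (parity x != g x)%:R : R).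
Proof.
move=> kg kn.
have n0 : (0 < n)%N by apply: leq_trans kn; rewrite muln_gt0 expn_gt0.
have n0R : 0 < n%:R :> R by rewrite ltr0n.
set u : R := n%:R^-1; have u0 : 0 < u by rewrite invr_gt0.
have nu : n%:R * u = 1 by rewrite mulfV // gt_eqF.
have u1 : u <= 1 by rewrite invf_le1 // ler1n.
have knR : 4 * k.+1%:R ^+ 2 * u <= 1.
  by rewrite -[leRHS]nu ler_pM2r // -natrX -natrM ler_nat.
rewrite -scd_partition.
have le_sum : \sum_(c <- scd n) ((size c)%:R *
    (- 1 + (size c)%:R ^+ 2 * u - ((size c)%:R ^+ 2 * u) ^+ 2 / 10)) <=
    6 * (\sum_(c <- scd n) \sum_(x <- c) (parity x != g x)%:R) :> R.
  rewrite mulr_sumr big_seq [leRHS]big_seq; apply: ler_sum => c /scd_sorted sc.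
  have -> : \sum_(x <- c) (parity x != g x)%:R =
            (count (fun x => parity x != g x) c)%:R :> R.
    by rewrite -natr_sum -sum1_count [in RHS]big_mkcond.
  apply: (@chain_minorant _ _ _ k.+1%:R) => //; first by rewrite ler1n.
  by rewrite -natrM -natrD ler_nat; apply: chain_disagreements.
(* The main terms add up to -1 + 3 - 15/10 = 1/2; the factor 6 of [chain_minorant] turns this into
   1/12. *)
have sumE : \sum_(c <- scd n) ((size c)%:R *
    (- 1 + (size c)%:R ^+ 2 * u - ((size c)%:R ^+ 2 * u) ^+ 2 / 10)) =
    2 ^+ n * (1 / 2 + u - u ^+ 2 / 10) :> R.
  transitivity (- \sum_(c <- scd n) (size c)%:R
     + u * (\sum_(c <- scd n) (size c)%:R ^+ 3)
     - u ^+ 2 / 10 * \sum_(c <- scd n) (size c)%:R ^+ 5 : R).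
    rewrite -sumrN !mulr_sumr -sumrN -!big_split /=.
    by apply: eq_bigr => c _; field.
  rewrite scd_moment1 scd_moment3 scd_moment5.
  have -> : u * (2 ^+ n * (3 * n%:R + 1)) = 2 ^+ n * (3 * (n%:R * u) + u) by ring.
  have -> : u ^+ 2 / 10 * (2 ^+ n * (15 * n%:R ^+ 2 + 1)) =
     2 ^+ n * (3 / 2 * (n%:R * u) ^+ 2 + u ^+ 2 / 10) by field.
  by rewrite nu; field.
have half : 2 ^+ n * (1 / 2) <= 2 ^+ n * (1 / 2 + u - u ^+ 2 / 10) :> R.
  rewrite ler_pM2l ?exprn_gt0 //.
  have : u ^+ 2 <= 1 * u by rewrite expr2 ler_pM2r.
  lra.
rewrite sumE in le_sum; lra.
Qed.

(** * Concentration of the middle layers *)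

Section Deviation.
Variables (R : realFieldType) (d : nat).

Definition sign (b : bool) : R := if b then 1 else - 1.

(** This is 2 |x_A| - |A|, centred so that its second moment is its variance |A|. *)
Definition imbalance (A : {pred 'I_d}) (x : cube d) : R :=
  \sum_(i in A) sign (x i).

Lemma card_cube : #|{: cube d}| = (2 ^ d)%N.
Proof. by rewrite card_ffun card_bool card_ord. Qed.

Lemma sum_sign_sign (i j : 'I_d) :
  \sum_(x : cube d) sign (x i) * sign (x j) = (i == j)%:R * 2 ^+ d.
Proof.
have [->|ij] := eqVneq i j.
  rewrite mul1r -natrX -card_cube -sumr_const; apply: eq_bigr => x _.
  by rewrite /sign; case: (x j); rewrite ?mulrNN mulr1.
rewrite mul0r; set E := LHS.
pose h (x : cube d) : cube d := [ffun l => (l == i) (+) x l].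
have hK : involutive h by move=> x; apply/ffunP => l; rewrite !ffunE addKb.
have : E = - E.
  rewrite {1}/E (reindex_inj (inv_inj hK)) -sumrN; apply: eq_bigr => x _.
  rewrite !ffunE eqxx eq_sym (negPf ij) /= /sign.
  by case: (x i); rewrite /= ?mul1r ?mulNr ?mul1r ?opprK.
lra.
Qed.

Lemma sum_imbalance_sqr (A : {pred 'I_d}) :
  \sum_x imbalance A x ^+ 2 = #|A|%:R * 2 ^+ d.
Proof.
under eq_bigr => x _ do rewrite expr2 mulr_suml.
rewrite exchange_big /= -sum1_card natr_sum mulr_suml.
apply: eq_bigr => i iA; under eq_bigr => x _ do rewrite mulr_sumr.
rewrite exchange_big /= (bigD1 i) //= sum_sign_sign eqxx big1 ?addr0 //.
by move=> j /andP[_ ji]; rewrite sum_sign_sign eq_sym (negPf ji) mul0r.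
Qed.

(** Chebyshev: the indicator dominates 1 - Y^2 / (4 d), with Y the imbalance, and Y has variance |A|
    <= d. *)
Lemma imbalance_concentration (A : {pred 'I_d}) (w : R) :
  0 <= w -> w ^+ 2 = 4 * d%:R -> (0 < d)%N ->
  3 / 4 * 2 ^+ d <= \sum_(x : cube d) (`|imbalance A x| <= w)%R%:R :> R.
Proof.
move=> w0 w2 d0; have d0R : 0 < d%:R :> R by rewrite ltr0n.
have : \sum_(x : cube d) (1 - imbalance A x ^+ 2 / (4 * d%:R)) <=
       \sum_(x : cube d) (`|imbalance A x| <= w)%R%:R :> R.
  apply: ler_sum => x _; case: (leP `|imbalance A x| w) => yw.
    by rewrite lerBlDr lerDl divr_ge0 ?sqr_ge0 // mulr_ge0.
  rewrite subr_le0 ler_pdivlMr ?mulr_gt0 // mul1r -w2 -[leRHS]real_normK ?num_real //.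
  by rewrite ler_sqr ?nnegrE // ltW.
apply: le_trans.
rewrite sumrB sumr_const card_cube -mulr_suml sum_imbalance_sqr natrX.
have : #|A|%:R <= d%:R :> R by rewrite ler_nat -[leqRHS]card_ord max_card.
move=> Ad; have p : 0 < 2 ^+ d :> R by rewrite exprn_gt0.
have : #|A|%:R * 2 ^+ d / (4 * d%:R) <= 2 ^+ d / 4 :> R.
  rewrite ler_pdivrMr ?mulr_gt0 //.
  have -> : 2 ^+ d / 4 * (4 * d%:R) = d%:R * 2 ^+ d :> R by field.
  by rewrite ler_pM2r.
lra.
Qed.

Lemma imbalance_le (A : {pred 'I_d}) (x y : cube d) : cube_le x y ->
  imbalance A y = imbalance A x + 2 * #|[pred i in A | x i != y i]|%:R.
Proof.
move=> /cube_leP xy; rewrite -sum1_card natr_sum mulr_sumr /imbalance.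
under [X in _ + X]eq_bigl => i do rewrite inE.
rewrite [X in _ + X]big_mkcondr -big_split /=; apply: eq_bigr => i _.
have := xy i; rewrite /sign; case: (x i); case: (y i) => /= h;
  [lra | by have := h isT | lra | lra].
Qed.

End Deviation.

(** * The hard function: its distance from [k]-monotone and its violations *)

Section HardFunction.
Variables (R : realFieldType) (d s k : nat) (psi : 'I_s -> 'I_d) (w : R).
Hypotheses (psi_inj : injective psi) (w_ge0 : 0 <= w).

Definition off_image : {pred 'I_d} := [pred i | i \notin codom psi].

Definition restrict (x : cube d) : cube s := [ffun j => x (psi j)].

Definition overwrite (x : cube d) (z : cube s) : cube d :=
  [ffun i => if [pick j | psi j == i] is Some j then z j else x i].

(* The value [odd k] above the middle layers is the one that a chain with
   [k - 1] alternations from [true] ends with, so the [k]-th alternation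
   cannot happen there. *)
Definition hard (x : cube d) : bool :=
  if imbalance R off_image x < - w then false
  else if w < imbalance R off_image x then odd k
  else parity (restrict x).

Lemma overwrite_psi x z j : overwrite x z (psi j) = z j.
Proof.
rewrite ffunE; case: pickP => [j' /eqP /psi_inj -> //|/(_ j)].
by rewrite eqxx.
Qed.

Lemma overwrite_off x z i : i \in off_image -> overwrite x z i = x i.
Proof.
rewrite inE ffunE => iN; case: pickP => // j /eqP ji.
by rewrite -ji codom_f in iN.
Qed.

Lemma restrict_overwrite x z : restrict (overwrite x z) = z.
Proof. by apply/ffunP => j; rewrite ffunE overwrite_psi. Qed.

Lemma overwrite_overwrite x z : overwrite (overwrite x z) (restrict x) = x.
Proof.
apply/ffunP => i; have [|iN] := boolP (i \in codom psi).
  by case/codomP => j ->; rewrite overwrite_psi ffunE.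
by rewrite !overwrite_off.
Qed.

Lemma imbalance_overwrite x z :
  imbalance R off_image (overwrite x z) = imbalance R off_image x.
Proof. by apply: eq_bigr => i iN; rewrite overwrite_off. Qed.

Lemma overwrite_le x z z' : cube_le z z' -> cube_le (overwrite x z) (overwrite x z').
Proof.
move=> /cube_leP zz'; apply/cube_leP => i; rewrite !ffunE.
by case: pickP => // j _; apply: zz'.
Qed.

Lemma k_monotone_overwrite (g : cube d -> bool) x :
  k_monotone k g -> k_monotone k (fun z => g (overwrite x z)).
Proof.
move=> kg [z [zle [z0 zalt]]]; apply: kg; exists (fun i => overwrite x (z i)).
by split=> // i ik; apply/overwrite_le/zle.
Qed.

(** Exchanging [z] with the hidden coordinates of [x] is an involution on pairs, so resampling these
    coordinates preserves the uniform measure. *)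
Lemma sum_overwrite (V : nmodType) (F : cube d -> V) :
  \sum_x \sum_z F (overwrite x z) = (\sum_y F y) *+ 2 ^ s.
Proof.
pose h (p : cube d * cube s) := (overwrite p.1 p.2, restrict p.1).
have hK : involutive h.
  by case=> x z; rewrite /h /= overwrite_overwrite restrict_overwrite.
rewrite pair_bigA /= (reindex_inj (inv_inj hK)) /=.
under eq_bigr => p _ do rewrite overwrite_overwrite.
rewrite -(pair_bigA _ (fun x (z : cube s) => F x)) /= -sumrMnl.
by apply: eq_bigr => x _; rewrite sumr_const card_cube.
Qed.

(** Fixing the other coordinates in the middle layers leaves a subcube on which [hard] is parity, at
    distance 1/12; this happens for at least 3/4 of all points. *)
Lemma hard_far : (0 < d)%N -> w ^+ 2 = 4 * d%:R -> (4 * k.+1 ^ 2 <= s)%N ->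
  forall g : cube d -> bool, k_monotone k g ->
  2 ^+ d / 16 <= (\sum_x (hard x != g x)%:R : R).
Proof.
move=> d0 w2 ks g kg; set D : R := \sum_x _.
have : \sum_x (`|imbalance R off_image x| <= w)%R%:R * (2 ^+ s / 12) <= D *+ 2 ^ s.
  rewrite -sum_overwrite; apply: ler_sum => x _.
  have [|_] := leP `|imbalance R off_image x| w; last first.
    by rewrite mul0r sumr_ge0.
  rewrite ler_norml => /andP[lw uw]; rewrite mul1r.
  apply: le_trans (parity_far R (@k_monotone_overwrite _ x kg) ks) _.
  apply: ler_sum => z _.
  by rewrite /hard imbalance_overwrite !ltNge lw uw /= restrict_overwrite.
rewrite -mulr_suml -[D *+ _]mulr_natr natrX; set M := \sum_x _ => le_D.
have p : 0 < 2 ^+ s :> R by rewrite exprn_gt0.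
have := imbalance_concentration off_image w_ge0 w2 d0.
rewrite -/M => le_M.
have {le_D} : M / 12 <= D.
  rewrite -(ler_pM2r p); apply: le_trans le_D.
  by rewrite le_eqVlt; apply/orP; left; apply/eqP; field.
lra.
Qed.

Lemma weight_diff (x y : cube s) :
  (weight y <= weight x + #|[pred j | x j != y j]|)%N.
Proof.
rewrite /weight -sum1_card [X in (_ <= _ + X)%N]big_mkcond -big_split /=.
by apply: leq_sum => j _; rewrite !inE; case: (x j); case: (y j).
Qed.

Lemma imbalance_mono x y : cube_le x y ->
  imbalance R off_image x <= imbalance R off_image y.
Proof. by move=> xy; rewrite (imbalance_le _ _ xy) lerDl mulr_ge0. Qed.

(** Between middle points the values are parities, so each alternation strictly raises the weight on
    the hidden coordinates. [hard a] already keeps the chain from lying below the middle. *)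
Lemma hard_alt_chain (P : pred (cube d)) n x :
  alt_chain_below P hard n.+1 x ->
  exists a b, [/\ P a, P b, hard a, hard b = ~~ odd n &
    [/\ cube_le a b, cube_le b x & imbalance R off_image b <= w ->
      (weight (restrict a) + n <= weight (restrict b))%N]].
Proof.
elim: n x => [|n IH] x.
  move=> /existsP[a /and4P[Pa ax /eqP fa _]].
  by exists a, a; split=> //; split=> //; [apply: cube_le_refl | rewrite addn0].
move=> /existsP[c /and4P[Pc cx /eqP fc hc]].
have [a [b [Pa Pb fa fb [ab bc wb]]]] := IH _ hc.
exists a, c; split=> //; split=> //; first exact: cube_le_trans ab bc.
move=> cw.
have bw := le_trans (imbalance_mono bc) cw.
have aw : - w <= imbalance R off_image a.
  by move: fa; rewrite /hard; case: ltP.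
have aw' := le_trans aw (imbalance_mono ab).
have aw'' := le_trans aw' (imbalance_mono bc).
have pb : hard b = parity (restrict b) by rewrite /hard !ltNge aw' bw.
have pc : hard c = parity (restrict c) by rewrite /hard !ltNge aw'' cw.
rewrite addnS; apply: leq_ltn_trans (wb bw) _.
rewrite ltn_neqAle; apply/andP; split; last first.
  apply: weight_le; apply/cube_leP => j; rewrite !ffunE; exact: (cube_leP _ _ bc).
apply/eqP => wbc; move: fc; rewrite pc /parity -wbc -/(parity _) -pb fb /=.
by case: (odd n).
Qed.

(** The top [b] has value [~~ odd k], unlike the points above the middle, so both ends are in the
    middle. Off the hidden coordinates they differ in half the rise of the imbalance, at most [w];
    on them, in at most [s] places. *)
Lemma hard_violation (P : pred (cube d)) x : alt_chain_below P hard k.+1 x ->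
  exists a b, [/\ P a, P b,
    (k <= #|[pred j | a (psi j) != b (psi j)]|)%N &
    #|[pred i | a i != b i]|%:R <= w + s%:R].
Proof.
move=> /hard_alt_chain[a [b [Pa Pb fa fb [ab _ wb]]]]; exists a, b.
have aw : - w <= imbalance R off_image a.
  by move: fa; rewrite /hard; case: ltP.
have bw : imbalance R off_image b <= w.
  have aw' := le_trans aw (imbalance_mono ab).
  move: fb; rewrite /hard ltNge aw' /=; case: ltP => // _.
  by case: (odd k).
split=> //.
  have := leq_trans (wb bw) (weight_diff (restrict a) (restrict b)).
  by rewrite leq_add2l (@eq_card _ _ [pred j | a (psi j) != b (psi j)]) // => j;
    rewrite !inE !ffunE.
rewrite -(cardID [in codom psi]) natrD addrC; apply: lerD.
  have := imbalance_le R off_image ab.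
  rewrite (@eq_card _ _ [predD [pred i | a i != b i] & [in codom psi]]).
    by move=> e; rewrite e in bw; lra.
  by move=> i; rewrite !inE.
rewrite ler_nat -[leqRHS]card_ord -(card_codom psi_inj).
by apply: subset_leq_card; apply/subsetP => i /andP[].
Qed.

End HardFunction.

(** * Chernoff bound for a random transversal of disjoint blocks *)

Section Chernoff.
Variables (R : realType) (I : finType) (s b : nat) (e : 'I_s * 'I_b -> I).
Hypothesis e_inj : injective e.

(** Choices in distinct blocks are independent, so the sum factors; 1 + y <= e^y bounds each factor,
    and injectivity of [e] bounds the sum of the [t j] by |T|. *)
Lemma exp_moment (T : {pred I}) (mu : R) : 0 <= mu -> (0 < b)%N ->
  \sum_(phi : {ffun 'I_s -> 'I_b}) (1 + mu) ^+ #|[pred j | e (j, phi j) \in T]|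
  <= b%:R ^+ s * expR (mu * #|T|%:R / b%:R).
Proof.
move=> mu0 b0; have b0R : 0 < b%:R :> R by rewrite ltr0n.
pose t j := #|[pred a | e (j, a) \in T]|.
have -> : \sum_(phi : {ffun 'I_s -> 'I_b})
    (1 + mu) ^+ #|[pred j | e (j, phi j) \in T]| =
    \prod_j \sum_a (if e (j, a) \in T then 1 + mu else 1).
  rewrite bigA_distr_bigA /=; apply: eq_bigr => phi _.
  by rewrite -big_mkcond /= prodr_const.
have sum_t : \sum_j (t j)%:R <= #|T|%:R :> R.
  rewrite -natr_sum ler_nat.
  have -> : (\sum_j t j = #|[pred p | e p \in T]|)%N.
    rewrite -sum1_card (eq_bigl (fun p => e (p.1, p.2) \in T)); last by case.
    rewrite -(pair_big_dep predT (fun j a => e (j, a) \in T) (fun _ _ => 1%N)) /=.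
    by apply: eq_bigr => j _; rewrite sum1_card.
  rewrite -(card_image e_inj); apply: subset_leq_card.
  by apply/subsetP => i /imageP[p Tp ->].
apply: (@le_trans _ _ (\prod_(j < s) (b%:R * expR (mu * (t j)%:R / b%:R)))); last first.
  rewrite big_split /= prodr_const card_ord ler_pM2l ?exprn_gt0 //.
  rewrite -expR_sum ler_expR -mulr_suml -mulr_sumr.
  by rewrite ler_pM2r ?invr_gt0 // ler_wpM2l.
apply: ler_prod => j _; apply/andP; split.
  by apply: sumr_ge0 => a _; case: ifP => // _; rewrite addr_ge0.
have -> : \sum_a (if e (j, a) \in T then 1 + mu else 1) = b%:R + mu * (t j)%:R.
  rewrite /t -[b in b%:R]card_ord -!sum1_card !natr_sum mulr_sumr.
  rewrite [X in _ = _ + X]big_mkcond -big_split /=; apply: eq_bigr => a _.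
  by rewrite inE; case: ifP => _; rewrite ?mulr1 ?addr0.
apply: le_trans (ler_wpM2l (ltW b0R) (expR_ge1Dx _)).
by rewrite mulrDr mulr1 lerD2l mulrCA mulfV ?mulr1 // gt_eqF.
Qed.

(** Markov's inequality for the exponential moment, with (1 + mu)^k weakened to mu^k. *)
Lemma card_many_hits (T : {pred I}) (k : nat) (mu : R) : 0 <= mu -> (0 < b)%N ->
  #|[pred phi : {ffun 'I_s -> 'I_b} | (k <= #|[pred j | e (j, phi j) \in T]|)%N]|%:R
    * mu ^+ k <= b%:R ^+ s * expR (mu * #|T|%:R / b%:R).
Proof.
move=> mu0 b0; apply: le_trans (exp_moment _ mu0 b0).
rewrite -sum1_card natr_sum mulr_suml [leRHS](bigID (fun phi : {ffun 'I_s -> 'I_b} =>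
  (k <= #|[pred j | e (j, phi j) \in T]|)%N)) /=.
rewrite -[leLHS]addr0; apply: lerD; last first.
  by apply: sumr_ge0 => phi _; rewrite exprn_ge0 // addr_ge0.
apply: ler_sum => phi kphi; rewrite mul1r.
apply: (@le_trans _ _ ((1 + mu) ^+ k)).
  by rewrite lerXn2r ?nnegrE ?addr_ge0 // lerDr.
by apply: ler_weXn2l => //; rewrite lerDl.
Qed.

End Chernoff.

(** * From one-sided testers to exposed pairs of queries *)

Section Tester.
Variables (R : realType) (d k q : nat) (eps : R) (Omega : finType) (p : Omega -> R).
Variables (Q : Omega -> q.-tuple (cube d)) (D : Omega -> q.-tuple bool -> bool).
Hypothesis tester : one_sided_nonadaptive_tester k eps p Q D.

(** Accepting [g] with probability 1 means that every seed of nonzero mass accepts [g], and this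
    seed sees the same answers on [f]. *)
Lemma reject_no_extension (f g : cube d -> bool) (om : Omega) :
  p om != 0 -> k_monotone k g -> {in Q om, g =1 f} ->
  D om (map_tuple f (Q om)).
Proof.
case: tester => [[p0 p1] [acc _]] pom kg gf.
have -> : map_tuple f (Q om) = map_tuple g (Q om).
  by apply/val_inj/eq_in_map => x /gf.
apply/negPn/negP => rej; move: p1.
rewrite (bigID (fun om => D om (map_tuple g (Q om)))) /= [X in X + _](acc g kg).
move=> /eqP; rewrite -[X in _ == X]addr0 (inj_eq (addrI _)).
by rewrite psumr_eq0 // => /allP /(_ om); rewrite mem_index_enum rej (negPf pom) => /(_ isT).
Qed.

Lemma reject_far (f : cube d -> bool) : far_from_k_monotone k eps f ->
  2 / 3 <= \sum_(om | ~~ D om (map_tuple f (Q om))) p om.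
Proof.
case: tester => [[p0 p1] [_ [_ rej]]] /rej; rewrite /accept_prob -[X in X - _]p1.
rewrite (bigID (fun om => D om (map_tuple f (Q om)))) /=.
by rewrite addrAC subrr add0r.
Qed.

(* Yao-style averaging over a family [f] of far functions, each pair of queries
   being able to expose only few members of the family. *)
Lemma tester_query_bound (Phi : finType) (f : Phi -> cube d -> bool)
    (expose : Phi -> rel (cube d)) (m : R) :
  (forall phi, far_from_k_monotone k eps (f phi)) ->
  (forall phi (P : pred (cube d)),
     (forall x y, P x -> P y -> ~~ expose phi x y) ->
     forall x, ~~ alt_chain_below P (f phi) k.+1 x) ->
  (forall x y, #|[pred phi | expose phi x y]|%:R <= m) ->
  2 / 3 * #|Phi|%:R <= q%:R ^+ 2 * m.
Proof.
move=> farf expf few; have [[p0 p1] _] := tester.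
have m0 : 0 <= m.
  by have z : cube d := [ffun=> false]; apply: le_trans (few z z).
have bound om : \sum_phi (~~ D om (map_tuple (f phi) (Q om)))%:R * p om <=
    q%:R ^+ 2 * m * p om.
  rewrite -mulr_suml; have [->|pom] := eqVneq (p om) 0; first by rewrite !mulr0.
  apply: ler_wpM2r => //.
  (* Union bound over ordered pairs of queries: a rejecting seed has an exposed pair, since
     otherwise its answers would extend to a [k]-monotone function. *)
  apply: (@le_trans _ _ (\sum_phi \sum_(ij : 'I_q * 'I_q)
      (expose phi (tnth (Q om) ij.1) (tnth (Q om) ij.2))%:R)).
    apply: ler_sum => phi _; case: (boolP (D _ _)) => [_|rej].
      by rewrite sumr_ge0.
    have [/existsP[ij eij]|] := boolP [exists ij : 'I_q * 'I_q,
      expose phi (tnth (Q om) ij.1) (tnth (Q om) ij.2)].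
      by rewrite (bigD1 ij) //= eij lerDl sumr_ge0.
    move=> /existsPn noexp; case/negP: rej.
    have [|g kg gf] := @k_monotone_extension _ [in Q om] (f phi) k.
      apply: expf => x y /tnthP[i ->] /tnthP[j ->]; exact: (noexp (i, j)).
    exact: (reject_no_extension pom kg).
  rewrite exchange_big /=.
  apply: (@le_trans _ _ (\sum_(ij : 'I_q * 'I_q) m)).
    apply: ler_sum => ij _; apply: le_trans (few (tnth (Q om) ij.1) (tnth (Q om) ij.2)).
    rewrite -sum1_card natr_sum [leRHS]big_mkcond; apply: ler_sum => phi _.
    by rewrite inE; case: (expose _ _ _).
  by rewrite sumr_const card_prod card_ord -[m *+ _]mulr_natl natrM -expr2.
have : \sum_(phi : Phi) (2 / 3 : R) <=
    \sum_phi \sum_om (~~ D om (map_tuple (f phi) (Q om)))%:R * p om.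
  apply: ler_sum => phi _; apply: le_trans (reject_far (farf phi)) _.
  rewrite [leLHS]big_mkcond; apply: ler_sum => om _.
  by case: (D _ _); rewrite /= ?mul0r ?mul1r.
rewrite sumr_const -[_ *+ #|_|]mulr_natr exchange_big /= => /le_trans; apply.
apply: le_trans (ler_sum _ (fun om _ => bound om)) _.
by rewrite -mulr_sumr p1 mulr1.
Qed.

End Tester.

(** * Choice of parameters and the final bound *)

Lemma k_le_quartic (R : realType) (d k : nat) :
  k%:R <= (d%:R : R) `^ (1 / 4%:R) / 2%:R -> (16 * k ^ 4 <= d)%N.
Proof.
move=> kd; rewrite -(ler_nat R) natrM natrX.
have le2k : 2 * k%:R <= (d%:R : R) `^ (1 / 4%:R) by lra.
have -> : d%:R = ((d%:R : R) `^ (1 / 4%:R)) ^+ 4.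
  by rewrite -powR_mulrn ?powR_ge0 // -powRrM div1r mulVf ?pnatr_eq0 // powRr1.
have -> : 16%:R * k%:R ^+ 4 = (2 * k%:R) ^+ 4 :> R by ring.
by rewrite lerXn2r ?nnegrE ?powR_ge0 ?mulr_ge0.
Qed.

Lemma block_embedding (d s b : nat) : (s * b <= d)%N ->
  exists e : 'I_s * 'I_b -> 'I_d, injective e.
Proof.
move=> sbd; have sb : (#|{: 'I_s * 'I_b}| <= d)%N by rewrite card_prod !card_ord.
exists (fun p => widen_ord sb (enum_rank p)) => p p' /(congr1 val) /= /val_inj.
exact: enum_rank_inj.
Qed.

(** The crude bound e <= 4, from e^(-1/2) >= 1/2. *)
Lemma expR_nat_le (R : realType) (n : nat) : expR n%:R <= 4 ^+ n :> R.
Proof.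
rewrite -[n%:R]mulr1 expRM_natl lerXn2r ?nnegrE ?expR_ge0 //.
have h0 : 0 < expR (1 / 2) :> R by apply: expR_gt0.
have h : expR (1 / 2) <= 2 :> R.
  have := expR_ge1Dx (- (1 / 2) : R); rewrite expRN => le.
  have : (1 - 1 / 2) * expR (1 / 2) <= 1 :> R.
    by rewrite -[leRHS](mulVf (lt0r_neq0 h0)) ler_pM2r.
  lra.
have -> : expR 1 = expR (1 / 2) * expR (1 / 2) :> R.
  by rewrite -expRD; congr expR; field.
have -> : 4 = 2 * 2 :> R by ring.
by apply: ler_pM => //; apply: ltW.
Qed.

Lemma query_bound_sqr (R : realType) (d k q : nat) (Omega : finType) (p : Omega -> R)
    (Q : Omega -> q.-tuple (cube d)) (D : Omega -> q.-tuple bool -> bool) :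
  (0 < k)%N -> (16 * k ^ 4 <= d)%N ->
  one_sided_nonadaptive_tester k (1 / 16) p Q D ->
  (Num.sqrt d%:R / (1152 * k%:R)) ^+ k <= q%:R ^+ 2 :> R.
Proof.
move=> k0 kd tester.
have d0 : (0 < d)%N by apply: leq_trans kd; rewrite muln_gt0 expn_gt0 k0.
(* [s] is the least size that [hard_far] allows; rounding the block length [b] down costs at most a
   factor 2 ([dsb]). *)
pose s := (4 * k.+1 ^ 2)%N; pose b := (d %/ s)%N.
have s0 : (0 < s)%N by rewrite muln_gt0 expn_gt0.
have sk : (s <= 16 * k ^ 2)%N by rewrite /s; nia.
have sd : (s <= d)%N by apply: leq_trans sk (leq_trans _ kd); nia.
have b0 : (0 < b)%N by rewrite divn_gt0.
have dsb : (d <= 2 * s * b)%N.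
  by have := ltn_ceil d s0; rewrite -/b mulSn; nia.
have [e e_inj] := @block_embedding d s b (ltac:(by rewrite mulnC leq_trunc_div)).
set r : R := Num.sqrt d%:R.
have r2 : r ^+ 2 = d%:R by rewrite sqr_sqrtr.
have r0 : 0 < r by rewrite sqrtr_gt0 ltr0n.
have k0R : 0 < k%:R :> R by rewrite ltr0n.
have b0R : 0 < b%:R :> R by rewrite ltr0n.
pose w := 2 * r; have w0 : 0 <= w by rewrite mulr_ge0 // ltW.
have w2 : w ^+ 2 = 4 * d%:R by rewrite /w -r2; ring.
(* By the quartic bound, s <= 16 k^2 <= 4 sqrt d, so the ends of a violation differ in at most w + s
   <= 6 sqrt d places. *)
have sr : s%:R <= 4 * r.
  have : s%:R <= 16 * k%:R ^+ 2 :> R by rewrite -natrX -natrM ler_nat.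
  have : 4 * k%:R ^+ 2 <= r.
    rewrite -ler_sqr ?nnegrE ?mulr_ge0 ?exprn_ge0 ?(ltW r0) // r2.
    have -> : (4 * k%:R ^+ 2) ^+ 2 = (16 * k ^ 4)%:R :> R by rewrite natrM natrX; ring.
    by rewrite ler_nat.
  lra.
pose psi (phi : {ffun 'I_s -> 'I_b}) j := e (j, phi j).
have psi_inj phi : injective (psi phi) by move=> j j' /e_inj [].
pose expose phi (x y : cube d) :=
  (k <= #|[pred j | x (psi phi j) != y (psi phi j)]|)%N &&
  (#|[pred i | x i != y i]|%:R <= 6 * r).
(* Chosen so that the exponent mu |T| / b is at most [k] once |T| <= 6 r. *)
pose mu := k%:R * b%:R / (6 * r).
have mu0 : 0 < mu by rewrite divr_gt0 ?mulr_gt0.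
have far phi : far_from_k_monotone k (1 / 16 : R) (hard k (psi phi) w).
  move=> g kg; have := hard_far (psi_inj phi) w0 d0 w2 (leqnn _) kg.
  rewrite /dist card_cube natrX ler_pdivlMr ?exprn_gt0 //.
  rewrite -sum1_card natr_sum [X in _ -> _ <= X]big_mkcond /=.
  under [X in _ -> _ <= X]eq_bigr => x _ do rewrite inE -mulrb.
  by apply: le_trans; rewrite mulrC mul1r.
have exposed phi (P : pred (cube d)) :
    (forall x y, P x -> P y -> ~~ expose phi x y) ->
    forall x, ~~ alt_chain_below P (hard k (psi phi) w) k.+1 x.
  move=> noexp x; apply/negP => /(hard_violation (psi_inj phi)).
  move=> [a [c [Pa Pc kac dac]]]; case/negP: (noexp _ _ Pa Pc).
  by rewrite /expose kac /=; apply: le_trans dac _; rewrite /w; lra.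
have few x y : #|[pred phi | expose phi x y]|%:R <=
    b%:R ^+ s * 4 ^+ k / mu ^+ k.
  rewrite ler_pdivlMr ?exprn_gt0 //.
  have [T_small|T_big] := leP (#|[pred i | x i != y i]|%:R : R) (6 * r); last first.
    rewrite (@eq_card0 _ [pred phi | expose phi x y]); last first.
      by move=> phi; rewrite inE /expose leNgt T_big andbF.
    by rewrite mul0r mulr_ge0 ?exprn_ge0 // ltW.
  rewrite (@eq_card _ _ [pred phi : {ffun 'I_s -> 'I_b} |
    (k <= #|[pred j | e (j, phi j) \in [pred i | x i != y i]]|)%N]); last first.
    by move=> phi; rewrite !inE /expose T_small andbT.
  apply: le_trans (card_many_hits e_inj _ _ (ltW mu0) b0) _.
  rewrite ler_pM2l ?exprn_gt0 //; apply: le_trans (expR_nat_le R k).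
  rewrite ler_expR /mu; set t := #|_|%:R in T_small *.
  have -> : k%:R * b%:R / (6 * r) * t / b%:R = k%:R * (t / (6 * r)).
    by field; rewrite !gt_eqF.
  by apply: ler_piMr; [exact: ltW | rewrite ler_pdivrMr ?mul1r ?mulr_gt0].
have := tester_query_bound tester far exposed few.
rewrite card_ffun !card_ord natrX => le_q.
have {}le_q : 2 / 3 * mu ^+ k <= q%:R ^+ 2 * 4 ^+ k.
  have p1 : 0 < b%:R ^+ s / mu ^+ k :> R by rewrite divr_gt0 ?exprn_gt0.
  rewrite -(ler_pM2r p1).
  have -> : 2 / 3 * mu ^+ k * (b%:R ^+ s / mu ^+ k) = 2 / 3 * b%:R ^+ s.
    by field; rewrite expf_neq0 // gt_eqF.
  by apply: le_trans le_q _; rewrite !mulrA [X in _ <= X / _]mulrAC.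
(* As k >= 1, the constant 2/3 is absorbed into the [k]-th power. *)
have le23 : (2 / 3) ^+ k <= 2 / 3 :> R.
  by rewrite -[leRHS]expr1; apply: ler_wiXn2l => //; lra.
(* From d <= 2 s b <= 32 k^2 b; then 1152 = 192 * 4 * 3/2 collects the constants. *)
have le_mu : r / (192 * k%:R) <= mu.
  rewrite /mu ler_pdivlMr ?mulr_gt0 // mulrAC ler_pdivrMr ?mulr_gt0 //.
  have : d%:R <= 32 * k%:R ^+ 2 * b%:R :> R.
    rewrite -natrX -!natrM ler_nat; apply: leq_trans dsb _.
    by rewrite leq_mul2r; apply/orP; right; lia.
  rewrite -r2; lra.
have -> : r / (1152 * k%:R) = 2 / 3 * (r / (192 * k%:R)) / 4.
  by field; rewrite gt_eqF.
rewrite exprMn exprVn ler_pdivrMr ?exprn_gt0 //; apply: le_trans le_q.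
rewrite exprMn; apply: ler_pM => //; rewrite ?exprn_ge0 ?divr_ge0 ?mulr_ge0 ?(ltW r0) //.
by rewrite lerXn2r ?nnegrE ?(ltW mu0) ?divr_ge0 ?mulr_ge0 ?(ltW r0).
Qed.

Theorem theorem1p1 :
  forall R : realType, exists eps : R, 0 < eps /\ exists c : R, 0 < c /\
  forall (d k : nat), (1 <= d)%N -> (1 <= k)%N ->
    (k%:R : R) <= ((d%:R : R) `^ (1 / 4%:R)) / 2%:R ->
  forall (q : nat) (Omega : finType) (p : Omega -> R)
         (Q : Omega -> q.-tuple (cube d)) (D : Omega -> q.-tuple bool -> bool),
    one_sided_nonadaptive_tester k eps p Q D ->
    (c * d%:R / (k ^ 2)%:R) `^ (k%:R / 4%:R) <= q%:R.
Proof.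
move=> R; exists (1 / 16); split; first by rewrite divr_gt0.
exists ((1152 ^+ 2)^-1); split; first by rewrite invr_gt0 exprn_gt0.
move=> d k _ k0 /k_le_quartic kd q Omega p Q D /(query_bound_sqr k0 kd).
set r := Num.sqrt _ / _ => le_q.
have r0 : 0 <= r by rewrite divr_ge0 ?sqrtr_ge0 ?mulr_ge0.
(* The base is r^2, so its power k/4 squares to r^k, the quantity bounded in [le_q]. *)
have -> : (1152 ^+ 2)^-1 * d%:R / (k ^ 2)%:R = r `^ 2%:R.
  rewrite powR_mulrn // /r expr_div_n sqr_sqrtr // natrX.
  by field; rewrite pnatr_eq0 -lt0n.
rewrite -ler_sqr ?nnegrE ?powR_ge0 //; apply: le_trans le_q.
rewrite -powR_mulrn ?powR_ge0 // -!powRrM -powR_mulrn //.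
have -> // : 2%:R * (k%:R / 4%:R * 2%:R) = k%:R :> R by field.
Qed.
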